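(* Let $f\colon F\to R$ and $g\colon G\to S$ be free covers of the maximal ideals of local rings $(R,\mathfrak{m},k)$ and $(S,\mathfrak{n})$, and let $(\phi,\alpha)\colon f\to g$ be a morphism in $\mathcal{F}$. Then the induced map $\operatorname{gr} H(\phi,\alpha)\colon \operatorname{gr} H(f)\to \operatorname{gr} H(g)$ is independent of the chosen lift $\phi$ of $\alpha$; that is, $\operatorname{gr} H(\phi,\alpha)=\operatorname{gr} H(\psi,\alpha)$ for any two lifts $\phi,\psi\colon F\to G$ of $\alpha$.
   Context: Local rings are commutative and noetherian; $(R,\mathfrak{m},k)$ denotes a local ring with maximal ideal $\mathfrak m$ and residue field $k$. A local homomorphism $\alpha\colon R\to (S,\mathfrak{n})$ is a ring map of local rings with $\alpha(\mathfrak m)\subseteq\mathfrak n$. A free cover of $\mathfrak m$ is an $R$-linear map $f\colon F\to R$ with $F$ a finite free $R$-module, $\operatorname{im}(f)=\mathfrak m$ and $\ker(f)\subseteq \mathfrak m F$. The category $\mathcal F$ has as objects the free covers of maximal ideals of local rings; a morphism from $f\colon F\to R$ to $g\colon G\to S$ is a pair $(\phi,\alpha)$ with $\alpha\colon R\to S$ a local homomorphism and $\phi\colon F\to G$ an $\alpha$-equivariant map (additive, with $\phi(rx)=\alpha(r)\phi(x)$) such that $g\phi=\alpha f$; one calls $\phi$ a lift of $\alpha$. $K(f)$ is the Koszul complex of $f$: the exterior algebra over $R$ on $F$ (in degree $1$) with the derivation differential induced by $f$; it is a dg $R$-algebra, with homology algebra $H(f)$. A morphism $(\phi,\alpha)$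 extends uniquely to an $\alpha$-equivariant morphism of dg algebras $K(\phi,\alpha)\colon K(f)\to K(g)$, inducing $H(\phi,\alpha)\colon H(f)\to H(g)$. Filtration: let $J$ be the kernel of the canonical augmentation $K(f)\to k$. For $l\ge 0$ set $\Phi^lK(f)=J^l$, so $\Phi^lK_i(f)=\mathfrak m^{l-i}K_i(f)$ (with $\mathfrak m^{j}=R$ for $j\le 0$), and $\Phi^lH(f)=\operatorname{im}(H(J^l)\to H(f))$; thus a class in $H_i(f)$ lies in $\Phi^l H(f)$ iff it is represented by a cycle in $\mathfrak m^{l-i}K_i(f)$. Set $\operatorname{gr}H(f)=\bigoplus_{l}\Phi^lH(f)/\Phi^{l+1}H(f)$. The map $H(\phi,\alpha)$ respects these filtrations and so induces $\operatorname{gr}H(\phi,\alpha)$. *)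

(* Defs.v *)
From HB Require Import structures.
From mathcomp Require Import all_boot all_order all_algebra.
From mathcomp Require Import ring boolp.

Set Implicit Arguments.
Unset Strict Implicit.
Unset Printing Implicit Defensive.

Import GRing.Theory VectorInternalTheory.
Local Open Scope ring_scope.

Section Ideals.
Variable R : comNzRingType.
Implicit Types (I M : R -> Prop).

Definition is_ideal I :=
  [/\ I 0, forall x y, I x -> I y -> I (x + y) & forall a x, I x -> I (a * x)].

Definition maximal_ideal M :=
  [/\ is_ideal M, ~ M 1
    & forall I, is_ideal I -> (forall x, M x -> I x) -> ~ I 1 ->
        forall x, I x -> M x].

Definition noetherian := forall I, is_ideal I ->
  exists s : seq R,
    forall x, I x <-> exists c : nat -> R, x = \sum_(i < size s) c i * s`_i.

End Ideals.

Record localRing := LocalRing {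
  ring_of :> comNzRingType;
  maxi : ring_of -> Prop;
  maxi_maximal : maximal_ideal maxi;
  maxi_unique : forall M : ring_of -> Prop, maximal_ideal M ->
    forall x, M x <-> maxi x;
  noetherian_of : noetherian ring_of
}.
Arguments maxi R x : clear implicits, rename.

Definition maxi_pred (R : localRing) : {pred R} := fun x => `[< maxi R x >].
Arguments maxi_pred R : clear implicits.

Lemma maxi_idealr_closed (R : localRing) : idealr_closed (maxi_pred R).
Proof.
have [[m0 mD mM] m1 _] := maxi_maximal R.
split; first exact/asboolP.
- exact/asboolPn.
- by move=> a u v /asboolP mu /asboolP mv; apply/asboolP/mD/mv/mM.
Qed.

HB.instance Definition _ (R : localRing) :=
  isIdealr.Build R (maxi_pred R) (maxi_idealr_closed R).

Definition residue (R : localRing) := {ideal_quot (maxi_pred R)}.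

(* The element [a] stands for the sum over [A] of [a A *: e_A], where
   [e_A = e_i1 * ... * e_ik] for [A = {i1 < ... < ik}].  The algebra generated by
   the [e_i] is identified as the exterior algebra by [ext_gen_sq] and
   [ext_universal] below. *)
Definition extn (R : comNzRingType) (n : nat) := {ffun {set 'I_n} -> R}.

HB.instance Definition _ (R : comNzRingType) n := GRing.Zmodule.on (extn R n).

Section ExtScale.
Variables (R : comNzRingType) (n : nat).
Implicit Types (r : R) (a : extn R n).

Definition ext_scale r a : extn R n := [ffun A => r * a A].

Lemma ext_scaleA r r' a : ext_scale r (ext_scale r' a) = ext_scale (r * r') a.
Proof. by apply/ffunP => A; rewrite !ffunE mulrA. Qed.

Lemma ext_scale1 : left_id 1 ext_scale.
Proof. by move=> a; apply/ffunP => A; rewrite ffunE mul1r. Qed.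

Lemma ext_scaleDr : right_distributive ext_scale +%R.
Proof. by move=> r a b; apply/ffunP => A; rewrite !ffunE mulrDr. Qed.

Lemma ext_scaleDl a : {morph ext_scale^~ a : r r' / r + r'}.
Proof. by move=> r r'; apply/ffunP => A; rewrite !ffunE mulrDl. Qed.

HB.instance Definition _ := GRing.Zmodule_isLmodule.Build R (extn R n)
  ext_scaleA ext_scale1 ext_scaleDr ext_scaleDl.

Lemma ext_scaleE r a A : (r *: a) A = r * a A.
Proof. by rewrite ffunE. Qed.

End ExtScale.

(* The number of inversions created by listing [A] before [B], so that
   [e_A * e_B = (-1) ^+ inv A B *: e_(A :|: B)] for disjoint [A] and [B]. *)
Definition inv n (A B : {set 'I_n}) : nat :=
  (\sum_(i in A) \sum_(j in B) (j < i))%N.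

Section Exterior.
Variables (R : comNzRingType) (n : nat).
Implicit Types (a b c : extn R n) (A B C : {set 'I_n}).

Definition ext_one : extn R n := [ffun A => (A == set0)%:R].

Definition ext_mul a b : extn R n :=
  [ffun C : {set 'I_n} =>
     \sum_(A : {set 'I_n} | A \subset C)
        (-1) ^+ inv A (C :\: A) * (a A * b (C :\: A))].

Definition ext_base A : extn R n := [ffun B => (B == A)%:R].

Lemma inv0l B : inv set0 B = 0%N.
Proof. by rewrite /inv big_set0. Qed.

Lemma inv0r B : inv B set0 = 0%N.
Proof. by rewrite /inv big1 // => i _; rewrite big_set0. Qed.

Lemma invUl A B C : [disjoint A & B] ->
  inv (A :|: B) C = (inv A C + inv B C)%N.
Proof.
move=> dAB; rewrite /inv (eq_bigl [predU A & B]) ?bigU //.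
by move=> i; rewrite !inE.
Qed.

Lemma invUr A B C : [disjoint A & B] ->
  inv C (A :|: B) = (inv C A + inv C B)%N.
Proof.
move=> dAB; rewrite /inv -big_split; apply: eq_bigr => i _ /=.
rewrite (eq_bigl [predU A & B]) ?bigU //.
by move=> j; rewrite !inE.
Qed.

Lemma inv11 (i j : 'I_n) : inv [set i] [set j] = (j < i)%N.
Proof. by rewrite /inv big_set1 big_set1. Qed.

Lemma ext_mulA : associative ext_mul.
Proof.
move=> a b c; apply/ffunP => D; rewrite !ffunE.
under eq_bigr => A _ do rewrite ffunE !mulr_sumr.
under [RHS]eq_bigr => C _ do rewrite ffunE mulr_suml mulr_sumr.
rewrite [RHS](exchange_big_dep (fun A : {set 'I_n} => A \subset D)) /=; last first.
  by move=> C A CD sAC; apply: subset_trans sAC CD.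
apply: eq_bigr => A AD.
rewrite [RHS](reindex_onto (fun B => A :|: B) (fun C => C :\: A)) /=; last first.
  by move=> C /andP[_ sAC]; rewrite setDE setUIr setUCr setIT; apply/setUidPr.
apply: eq_big => [B|B BDA].
  rewrite subUset AD subsetUl /= andbT subsetD; congr (_ && _).
  apply/idP/eqP=> [dBA|<-].
    by rewrite setDUl setDv set0U; apply/setDidPl.
  by rewrite disjoints_subset setDE subsetIr.
have dBA: [disjoint B & A] by move: BDA; rewrite subsetD => /andP[].
have dAB: [disjoint A & B] by rewrite disjoint_sym.
have -> : (A :|: B) :\: A = B by rewrite setDUl setDv set0U; apply/setDidPl.
rewrite -setDDl.
have E : D :\: A = B :|: (D :\: A :\: B).
  by rewrite -[LHS](setID _ B) (setIidPr _).
have dBD : [disjoint B & D :\: A :\: B].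
  by rewrite disjoints_subset; apply/subsetP => x xB; rewrite !inE xB.
rewrite invUl // {1}E invUr // !exprD.
by move: ((-1) ^+ _) ((-1) ^+ _) ((-1) ^+ _) => x y z; ring.
Qed.

Lemma ext_mul1l : left_id ext_one ext_mul.
Proof.
move=> a; apply/ffunP => C; rewrite ffunE (bigD1 (set0 : {set 'I_n})) ?sub0set //=.
rewrite big1 ?addr0; last by move=> A /andP[_ /negPf A0]; rewrite ffunE A0 mul0r mulr0.
by rewrite ffunE eqxx inv0l setD0 !mul1r.
Qed.

Lemma ext_mul1r : right_id ext_one ext_mul.
Proof.
move=> a; apply/ffunP => C; rewrite ffunE (bigD1 (C : {set 'I_n})) //=.
rewrite big1 ?addr0; last first.
  move=> A /andP[sAC AnC]; rewrite ffunE setD_eq0.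
  case CA: (C \subset A); last by rewrite !mulr0.
  by rewrite eqEsubset sAC CA in AnC.
by rewrite setDv ffunE eqxx inv0r mulr1 mul1r.
Qed.

Lemma ext_mulDl : left_distributive ext_mul +%R.
Proof.
move=> a b c; apply/ffunP => C; rewrite !ffunE -big_split.
by apply: eq_bigr => A _; rewrite !ffunE mulrDl mulrDr.
Qed.

Lemma ext_mulDr : right_distributive ext_mul +%R.
Proof.
move=> a b c; apply/ffunP => C; rewrite !ffunE -big_split.
by apply: eq_bigr => A _; rewrite !ffunE mulrDr mulrDr.
Qed.

Lemma ext_one_neq0 : ext_one != 0 :> extn R n.
Proof. by apply/eqP => /ffunP/(_ set0); rewrite !ffunE eqxx; apply/eqP/oner_neq0. Qed.

HB.instance Definition _ := GRing.Zmodule_isNzRing.Build (extn R n)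
  ext_mulA ext_mul1l ext_mul1r ext_mulDl ext_mulDr ext_one_neq0.

Lemma ext_scaleAl (r : R) (a b : extn R n) : r *: (a * b) = (r *: a) * b.
Proof.
apply/ffunP => C; rewrite ext_scaleE !ffunE mulr_sumr; apply: eq_bigr => A _.
by rewrite ext_scaleE -!mulrA mulrCA.
Qed.

Lemma ext_scaleAr (r : R) (a b : extn R n) : r *: (a * b) = a * (r *: b).
Proof.
apply/ffunP => C; rewrite ext_scaleE !ffunE mulr_sumr; apply: eq_bigr => A _.
by rewrite ext_scaleE mulrCA; congr (_ * _); rewrite mulrCA.
Qed.

HB.instance Definition _ :=
  GRing.Lmodule_isLalgebra.Build R (extn R n) ext_scaleAl.
HB.instance Definition _ :=
  GRing.Lalgebra_isAlgebra.Build R (extn R n) ext_scaleAr.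

(* The inclusion of the free module in degree 1. *)
Definition ext_gen (v : 'rV[R]_n) : extn R n :=
  \sum_i v 0 i *: ext_base [set i].

End Exterior.
Section ExteriorTheory.
Variables (R : comNzRingType) (n : nat).
Implicit Types (a b c : extn R n) (A B C : {set 'I_n}) (i j k : 'I_n).

Notation e A := (@ext_base R n A).

Lemma ext_base0 : e set0 = 1.
Proof. by []. Qed.

Lemma ext_expand a : a = \sum_A a A *: e A.
Proof.
apply/ffunP => C; rewrite sum_ffunE (bigD1 C) //= ext_scaleE ffunE eqxx.
rewrite mulr1 big1 ?addr0 // => A /negPf AC.
by rewrite ext_scaleE ffunE eq_sym AC mulr0.
Qed.

Lemma ext_base1M i a C : (e [set i] * a) C =
  if i \in C then (-1) ^+ inv [set i] (C :\ i) * a (C :\ i) else 0.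
Proof.
rewrite ffunE; case: ifPn => iC; last first.
  rewrite big1 // => A sAC; rewrite ffunE.
  case: eqP => [eA|_]; last by rewrite mul0r mulr0.
  by rewrite eA sub1set (negPf iC) in sAC.
rewrite (bigD1 [set i]) ?sub1set //= big1 => [|A /andP[_ /negPf Ai]].
  by rewrite addr0 ffunE eqxx mul1r.
by rewrite ffunE Ai mul0r mulr0.
Qed.

Lemma ext_base1M_base i A : e [set i] * e A =
  if i \in A then 0 else (-1) ^+ inv [set i] A *: e (i |: A).
Proof.
apply/ffunP => C; rewrite ext_base1M ffunE.
case: (boolP (i \in A)) => iA.
  rewrite ffunE; case: ifP => // iC; case: eqP => [eA|]; last by rewrite mulr0.
  by rewrite -eA !inE eqxx in iA.
rewrite ext_scaleE !ffunE.
case: ifPn => iC; last first.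
  by case: eqP => [eC|]; rewrite ?mulr0 //; rewrite eC !inE eqxx in iC.
case: (C :\ i =P A) => [eA|nA].
  by rewrite -eA setD1K // eqxx.
case: eqP => [eC|]; last by rewrite !mulr0.
by case: nA; rewrite eC setU1K.
Qed.

Lemma ext_ind (P : extn R n -> Prop) :
    (forall a b, P a -> P b -> P (a + b)) ->
    (forall (r : R) a, P a -> P (r *: a)) ->
    P 1 -> (forall i a, P a -> P (e [set i] * a)) ->
  forall a, P a.
Proof.
move=> PD PZ P1 Pe a; rewrite [a]ext_expand.
have P0 : P 0 by rewrite -(scale0r 1); apply: PZ.
apply: big_ind => // A _; apply: (PZ).
have [m] := ubnP #|A|; elim: m A => // m IHm A; rewrite ltnS => leAm.
have [->|[i iA]] := set_0Vmem A; first exact: P1.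
have -> : e A = (-1) ^+ inv [set i] (A :\ i) *: (e [set i] * e (A :\ i)).
  rewrite ext_base1M_base !inE eqxx /= setD1K // scalerA -expr2 sqrr_sign.
  by rewrite scale1r.
apply/PZ/Pe/IHm; apply: leq_trans leAm.
by rewrite [ltnRHS](cardsD1 i) iA.
Qed.

Lemma ext_gen_is_linear : linear (@ext_gen R n).
Proof.
move=> r u v; rewrite /ext_gen scaler_sumr -big_split; apply: eq_bigr => i _.
by rewrite /= !mxE scalerDl scalerA.
Qed.
HB.instance Definition _ :=
  GRing.isLinear.Build R 'rV[R]_n (extn R n) _ (@ext_gen R n) ext_gen_is_linear.

Lemma ext_gen_delta i : ext_gen (delta_mx 0 i) = e [set i].
Proof.
rewrite /ext_gen (bigD1 i) //= mxE !eqxx scale1r big1 ?addr0 // => j /negPf ji.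
by rewrite mxE ji andbF scale0r.
Qed.

Lemma ext_base1_sq i : e [set i] * e [set i] = 0.
Proof. by rewrite ext_base1M_base inE eqxx. Qed.

Lemma ext_base1_anti i j :
  e [set i] * e [set j] = - (e [set j] * e [set i]).
Proof.
have [->|ij] := eqVneq i j; first by rewrite ext_base1_sq oppr0.
rewrite !ext_base1M_base !inE (negPf ij) eq_sym (negPf ij) !inv11 setUC -scaleNr.
congr (_ *: _); case: ltngtP => [| |/val_inj eij]; rewrite ?expr0 ?expr1 ?opprK //.
by rewrite eij eqxx in ij.
Qed.

Lemma ext_gen_sq (v : 'rV[R]_n) : ext_gen v * ext_gen v = 0.
Proof.
rewrite /ext_gen mulr_suml.
suff H (s : seq 'I_n) : (\sum_(i <- s) v 0 i *: e [set i]) *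
    (\sum_(i <- s) v 0 i *: e [set i]) = 0 by rewrite -mulr_suml H.
elim: s => [|i s IHs]; first by rewrite big_nil mul0r.
rewrite !big_cons mulrDl !mulrDr IHs addr0 -scalerAl -scalerAr ext_base1_sq.
rewrite !scaler0 add0r mulr_sumr mulr_suml -big_split big1 // => j _ /=.
rewrite -!scalerAl -!scalerAr !scalerA ext_base1_anti scalerN mulrC.
by rewrite addNr.
Qed.

Lemma ext_gen_anti (v w : 'rV[R]_n) : ext_gen v * ext_gen w = - (ext_gen w * ext_gen v).
Proof.
have := ext_gen_sq (v + w); rewrite linearD mulrDl !mulrDr !ext_gen_sq add0r addr0.
by move/eqP; rewrite addr_eq0 => /eqP.
Qed.

Lemma ext_gen_mul0 (v : 'rV[R]_n) a : (ext_gen v * a) set0 = 0.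
Proof.
rewrite /ext_gen mulr_suml sum_ffunE big1 // => i _.
by rewrite -scalerAl ext_scaleE ext_base1M inE mulr0.
Qed.

(* The homomorphism from the exterior algebra to [T] extending [rho] on scalars
   and sending the i-th basis vector to [u i]. *)
Definition ext_lift (T : pzRingType) (rho : R -> T) (u : 'I_n -> T) a : T :=
  \sum_(A : {set 'I_n}) rho (a A) * \prod_(i in A) u i.

Section Lift.
Variables (T : pzRingType) (rho : {rmorphism R -> T}) (u : 'I_n -> T).
Hypothesis rho_comm : forall r i, rho r * u i = u i * rho r.
Hypothesis u_sq : forall i, u i * u i = 0.
Hypothesis u_anti : forall i j, u i * u j = - (u j * u i).

Let L := ext_lift rho u.

Lemma ext_liftD a b : L (a + b) = L a + L b.
Proof.
rewrite /L /ext_lift -big_split; apply: eq_bigr => A _.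
by rewrite ffunE rmorphD mulrDl.
Qed.

Lemma ext_liftZ (r : R) a : L (r *: a) = rho r * L a.
Proof.
rewrite /L /ext_lift mulr_sumr; apply: eq_bigr => A _.
by rewrite ext_scaleE rmorphM mulrA.
Qed.

Lemma ext_lift_base A : L (e A) = \prod_(i in A) u i.
Proof.
rewrite /L /ext_lift (bigD1 A) //= ffunE eqxx rmorph1 mul1r.
rewrite [X in _ + X]big1 ?addr0 //.
by move=> B /negPf BA; rewrite ffunE BA rmorph0 mul0r.
Qed.

Lemma ext_lift0 : L 0 = 0.
Proof. by rewrite -(scale0r 1) ext_liftZ rmorph0 mul0r. Qed.

Lemma ext_lift1 : L 1 = 1.
Proof. by rewrite -ext_base0 ext_lift_base big_set0. Qed.

Lemma mul_prod_set k A : u k * \prod_(i in A) u i =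
  if k \in A then 0 else (-1) ^+ inv [set k] A * \prod_(i in k |: A) u i.
Proof.
rewrite /inv big_set1.
suff H (s : seq 'I_n) : sorted (fun i j : 'I_n => i < j)%N s -> k \in s ->
  u k * \prod_(i <- s | i \in A) u i =
  if k \in A then 0 else (-1) ^+ (\sum_(j <- s | j \in A) (j < k))%N *
     \prod_(i <- s | i \in k |: A) u i.
  have sorted_enum : sorted (fun i j : 'I_n => i < j)%N (index_enum 'I_n).
    have -> : index_enum 'I_n = enum 'I_n by rewrite enumT [index_enum _]unlock.
    by have := iota_ltn_sorted 0 n; rewrite -val_enum_ord sorted_map.
  by apply: H; rewrite ?mem_index_enum.
have lt_trans : transitive (fun i j : 'I_n => i < j)%N by move=> ? ? ? /ltn_trans; apply.
elim: s => //= x s IHs; rewrite (path_sortedE lt_trans) => /andP[/allP xs s_sorted].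
rewrite inE !big_cons; have [->|kx] /= := eqVneq k x.
  move=> _; rewrite !inE eqxx /= ltnn.
  have xNs : x \notin s by apply/negP => /xs; rewrite ltnn.
  have [xA|xA] := ifPn; first by rewrite mulrA u_sq mul0r.
  rewrite [X in _ ^+ X]big_seq_cond [X in _ ^+ X]big1 => [|j]; last first.
    by move=> /andP[/xs /ltnW xj _]; rewrite ltnNge xj.
  rewrite mul1r.
  congr (_ * _); rewrite big_seq_cond [RHS]big_seq_cond; apply: eq_bigl => j.
  rewrite !inE; case: eqP => // ->; by rewrite (negPf xNs).
move=> ks; have {IHs} := IHs s_sorted ks; rewrite !inE eq_sym (negPf kx) /=.
case: (boolP (x \in A)) => xA //.
move=> IH; rewrite mulrA u_anti mulNr -mulrA IH.
case: ifP => _; first by rewrite mulr0 oppr0.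
rewrite (xs _ ks) exprD expr1 mulN1r mulNr; congr (- _).
by rewrite mulrA -commr_sign -mulrA.
Qed.

Lemma ext_lift_baseM k a : L (e [set k] * a) = u k * L a.
Proof.
rewrite [a]ext_expand mulr_sumr.
have LS (F : {set 'I_n} -> extn R n) : L (\sum_A F A) = \sum_A L (F A).
  by apply: (big_morph L ext_liftD ext_lift0).
rewrite !LS mulr_sumr; apply: eq_bigr => A _.
rewrite -scalerAr !ext_liftZ ext_lift_base mulrA -rho_comm -mulrA; congr (_ * _).
rewrite ext_base1M_base mul_prod_set; case: ifP => _; first exact: ext_lift0.
by rewrite ext_liftZ ext_lift_base rmorph_sign.
Qed.

Lemma ext_liftM a b : L (a * b) = L a * L b.
Proof.
elim/ext_ind: a b => [a a' IHa IHa' b|r a IHa b|b|i a IHa b].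
- by rewrite mulrDl !ext_liftD IHa IHa' mulrDl.
- by rewrite -scalerAl !ext_liftZ IHa mulrA.
- by rewrite ext_lift1 !mul1r.
- by rewrite -mulrA !ext_lift_baseM IHa mulrA.
Qed.

End Lift.

Lemma ext_universal (B : algType R) (h : {linear 'rV[R]_n -> B}) :
    (forall v, h v * h v = 0) ->
  exists L : extn R n -> B,
    [/\ linear L, monoid_morphism L & forall v, L (ext_gen v) = h v] /\
    forall L' : extn R n -> B,
      [/\ linear L', monoid_morphism L' & forall v, L' (ext_gen v) = h v] ->
      L' =1 L.
Proof.
move=> h_sq; pose u i := h (delta_mx 0 i); pose L := ext_lift (in_alg B) u.
have u_anti i j : u i * u j = - (u j * u i).
  have := h_sq (delta_mx 0 i + delta_mx 0 j).
  rewrite linearD mulrDl !mulrDr !h_sq add0r addr0.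
  by move/eqP; rewrite addr_eq0 => /eqP.
have u_comm (r : R) i : r%:A * u i = u i * r%:A by rewrite mulr_algl mulr_algr.
have LZ r a : L (r *: a) = r *: L a by rewrite [L _]ext_liftZ mulr_algl.
have LD a b : L (a + b) = L a + L b by apply: ext_liftD.
have LM a b : L (a * b) = L a * L b.
  by have := ext_liftM (rho := in_alg B) u_comm (fun i => h_sq _) u_anti; apply.
have L0 : L 0 = 0 by apply: ext_lift0.
have L1 : L 1 = 1 by apply: ext_lift1.
have Lb i : L (e [set i]) = u i by rewrite [L _]ext_lift_base big_set1.
exists L; split; first split.
- by move=> r a b; rewrite LD LZ.
- by split.
- move=> v; rewrite /ext_gen (big_morph L LD L0) [v in RHS]row_sum_delta linear_sum.
  by apply: eq_bigr => i _; rewrite LZ Lb linearZ.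
move=> L' [linL' [L'1 L'M] L'h].
have L'D a b : L' (a + b) = L' a + L' b by have := linL' 1 a b; rewrite !scale1r.
have L'0 : L' 0 = 0 by apply: (addrI (L' 0)); rewrite -L'D !addr0.
have L'Z r a : L' (r *: a) = r *: L' a.
  by have := linL' r a 0; rewrite L'0 !addr0.
elim/ext_ind => [a b IHa IHb|r a IHa||i a IHa].
- by rewrite L'D LD IHa IHb.
- by rewrite L'Z LZ IHa.
- by rewrite L'1 L1.
- by rewrite L'M LM -ext_gen_delta L'h ext_gen_delta Lb IHa.
Qed.

(* The differential sending [e_i] to [t i]; it is the derivation characterized by
   [ext_diff_gen] and [ext_diffM]. *)
Definition ext_diff (t : 'I_n -> R) a : extn R n :=
  [ffun B : {set 'I_n} =>
    \sum_(i | i \notin B) (-1) ^+ inv [set i] B * (t i * a (i |: B))].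

(* The grading involution: [ext_sign a = (-1) ^+ p *: a] for [a] of degree [p]. *)
Definition ext_sign a : extn R n := [ffun A : {set 'I_n} => (-1) ^+ #|A| * a A].

Section Derivation.
Variable t : 'I_n -> R.
Notation d := (ext_diff t).

Lemma ext_diff_is_linear : linear d.
Proof.
move=> r a b; apply/ffunP => B; rewrite ffunE ffunE ext_scaleE !ffunE.
rewrite mulr_sumr -big_split; apply: eq_bigr => i _; rewrite ffunE ext_scaleE.
by rewrite /= !mulrDr [t i * (r * _)]mulrCA [_ * (r * _)]mulrCA.
Qed.
HB.instance Definition _ :=
  GRing.isLinear.Build R (extn R n) (extn R n) _ d ext_diff_is_linear.

Lemma ext_sign_is_linear : linear ext_sign.
Proof.
move=> r a b; apply/ffunP => B.
by rewrite !(ffunE, ext_scaleE) mulrDr mulrCA.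
Qed.
HB.instance Definition _ :=
  GRing.isLinear.Build R (extn R n) (extn R n) _ ext_sign ext_sign_is_linear.

Lemma ext_diff1 : d 1 = 0.
Proof.
apply/ffunP => B; rewrite !ffunE big1 // => i _; rewrite ffunE.
case: eqP => [/setP/(_ i)|]; last by rewrite !mulr0.
by rewrite !inE eqxx.
Qed.

Lemma ext_sign1 : ext_sign 1 = 1.
Proof.
apply/ffunP => B; rewrite !ffunE; case: eqP => [->|]; last by rewrite mulr0.
by rewrite cards0 mul1r.
Qed.

Lemma ext_sign_base1M k a : ext_sign (e [set k] * a) = - (e [set k] * ext_sign a).
Proof.
apply/ffunP => B; rewrite ffunE ext_base1M [in RHS]ffunE ext_base1M.
case: ifP => kB; last by rewrite mulr0 oppr0.
rewrite ffunE (cardsD1 k B) kB exprD expr1 mulN1r mulNr; congr (- _).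
by rewrite mulrCA.
Qed.

Lemma ext_sign_gen (v : 'rV[R]_n) : ext_sign (ext_gen v) = - ext_gen v.
Proof.
rewrite /ext_gen linear_sum -sumrN; apply: eq_bigr => i _.
by rewrite linearZ /= -[e _]mulr1 ext_sign_base1M ext_sign1 scalerN.
Qed.

Lemma ext_diff_base1M k a : d (e [set k] * a) = t k *: a - e [set k] * d a.
Proof.
apply/ffunP => B.
have -> : (t k *: a - e [set k] * d a) B = t k * a B - (e [set k] * d a) B.
  by rewrite ffunE ext_scaleE ffunE.
rewrite ext_base1M ffunE.
under eq_bigr => i iB do rewrite ext_base1M.
have [kB|kB] := boolP (k \in B); last first.
  rewrite (bigD1 k) //= !inE eqxx /= setU1K // big1 => [|i /andP[iB ik]].
    by rewrite addr0 subr0 mulrCA [X in _ * X = _]mulrA -expr2 sqrr_sign mul1r.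
  by rewrite !inE eq_sym (negPf ik) (negPf kB) !mulr0.
rewrite ffunE [X in _ - _ * X](bigD1 k) ?inE ?eqxx //= setD1K //.
rewrite [X in _ = _ - X]mulrDr [X in _ = _ - (X + _)]mulrA -expr2 sqrr_sign mul1r.
rewrite opprD addrA subrr add0r mulr_sumr -sumrN.
apply: eq_big => [i|i iB].
  by rewrite !inE negb_and negbK; have [->|] := eqVneq i k; rewrite ?kB ?andbT.
have ik : i != k by apply: contraNneq iB => ->.
have -> : (i |: B) :\ k = i |: B :\ k.
  apply/setP => j; rewrite !inE; have [->|] := eqVneq j k; rewrite ?orbT //.
  by rewrite eq_sym (negPf ik).
have invk : inv [set i] B = ((k < i) + inv [set i] (B :\ k))%N.
  by rewrite -{1}(setD1K kB) invUr ?inv11 // disjoints1 !inE eqxx.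
have invi : inv [set k] (i |: B :\ k) = ((i < k) + inv [set k] (B :\ k))%N.
  by rewrite invUr ?inv11 // disjoints1 !inE (negPf iB) andbF.
rewrite !inE kB orbT invk invi !exprD.
have -> : (i < k)%N = ~~ (k < i)%N.
  by rewrite -leqNgt ltn_neqAle (inj_eq val_inj) ik.
move: ((-1) ^+ inv _ _) ((-1) ^+ inv _ _) => x y; case: (k < i)%N => /=; ring.
Qed.

Lemma ext_diffM a b : d (a * b) = d a * b + ext_sign a * d b.
Proof.
elim/ext_ind: a b => [a a' IHa IHa' b|r a IHa b|b|i a IHa b].
- by rewrite mulrDl !linearD /= IHa IHa' !mulrDl addrACA.
- by rewrite -scalerAl !linearZ /= IHa -!scalerAl scalerDr.
- by rewrite ext_diff1 ext_sign1 mul0r add0r !mul1r.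
- rewrite -mulrA !ext_diff_base1M IHa ext_sign_base1M mulrDr mulrBl scalerAl.
  by rewrite opprD addrA !mulrA mulNr.
Qed.

Lemma ext_diffK a : d (d a) = 0.
Proof.
elim/ext_ind: a => [a b IHa IHb|r a IHa||i a IHa].
- by rewrite !linearD /= IHa IHb addr0.
- by rewrite !linearZ /= IHa scaler0.
- by rewrite ext_diff1 linear0.
- by rewrite ext_diff_base1M linearB linearZ /= ext_diff_base1M IHa mulr0 subr0 subrr.
Qed.

Lemma ext_diff_gen (v : 'rV[R]_n) : d (ext_gen v) = (\sum_i v 0 i * t i)%:A.
Proof.
rewrite linear_sum scaler_suml; apply: eq_bigr => i _ /=.
rewrite linearZ /= -[e _]mulr1 ext_diff_base1M ext_diff1 mulr0 subr0.
by rewrite scalerA.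
Qed.

End Derivation.
End ExteriorTheory.

Section SubQuot.
Variables (V : zmodType) (P Q : zmodClosed V).

Record subgrp := SubGrp { subgrp_val : V; subgrpP : subgrp_val \in P }.
HB.instance Definition _ := [isSub for subgrp_val].
HB.instance Definition _ := [Choice of subgrp by <:].
HB.instance Definition _ := [SubChoice_isSubZmodule of subgrp by <:].

Definition subgrp_den : {pred subgrp} := fun z => val z \in Q.

Lemma subgrp_den_closed : zmod_closed subgrp_den.
Proof.
split; first by rewrite unfold_in raddf0 rpred0.
by move=> x y; rewrite !unfold_in raddfB; apply: rpredB.
Qed.
HB.instance Definition _ :=
  GRing.isZmodClosed.Build subgrp subgrp_den subgrp_den_closed.

(* [P / (P :&: Q)], that is [P / Q] when [Q] is contained in [P]. *)
Definition subquot := Quotient.quot subgrp_den.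
HB.instance Definition _ := GRing.Zmodule.on subquot.

Definition subquot_class (z : subgrp) : subquot := \pi_(Quotient.quot subgrp_den)%qT z.

Lemma subquot_class_eq x y :
  (subquot_class x = subquot_class y) <-> (val x - val y \in Q).
Proof.
rewrite -raddfB; split => [/eqP|xy].
  by rewrite /subquot_class -Quotient.idealrBE.
by apply/eqP; rewrite /subquot_class -Quotient.idealrBE.
Qed.

Lemma subquot_classB x y :
  subquot_class (x - y) = subquot_class x - subquot_class y.
Proof. exact: raddfB. Qed.

Lemma subquot_classK (x : subquot) : subquot_class (repr x) = x.
Proof. exact: reprK. Qed.

End SubQuot.

Section SubQuotMap.
Variables (V W : zmodType) (P Q : zmodClosed V) (P' Q' : zmodClosed W).
Variable h : {additive V -> W}.
Hypothesis hP : forall x, x \in P -> h x \in P'.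
Hypothesis hQ : forall x, x \in Q -> h x \in Q'.

Definition subgrp_map (z : subgrp P) : subgrp P' := SubGrp (hP (subgrpP z)).

(* [hQ] is only used to show that the choice of a representative is irrelevant:
   see [subquot_mapE]. *)
Definition subquot_map (x : subquot P Q) : subquot P' Q' :=
  subquot_class Q' (subgrp_map (repr x)).

Lemma subquot_mapE z :
  subquot_map (subquot_class Q z) = subquot_class Q' (subgrp_map z).
Proof.
apply/subquot_class_eq; rewrite /= -raddfB; apply/hQ/subquot_class_eq.
exact: subquot_classK.
Qed.

Lemma subquot_map_is_additive : zmod_morphism subquot_map.
Proof.
move=> x y; rewrite -[x]subquot_classK -[y]subquot_classK -subquot_classB.
rewrite !subquot_mapE -subquot_classB; congr (subquot_class _ _).
by apply: val_inj; rewrite /= raddfB.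
Qed.

End SubQuotMap.

Arguments subquot_map {V W P Q P' Q' h} hP x.

Section DirectSum.
Variable V : nat -> zmodType.

Record dsum := DSum {
  dsum_comp :> forall l, V l;
  dsum_fin : exists N, forall l, (N <= l)%N -> dsum_comp l = 0
}.

Lemma dsumP (x y : dsum) : (forall l, x l = y l) -> x = y.
Proof.
case: x y => [x finx] [y finy] /= xy.
have {}xy : x = y by apply: functional_extensionality_dep.
by move: xy finx finy => -> finx finy; congr DSum; apply: Prop_irrelevance.
Qed.

Lemma dsum0_fin : exists N, forall l, (N <= l)%N -> (0 : V l) = 0.
Proof. by exists 0%N. Qed.
Definition dsum0 := DSum dsum0_fin.

Lemma dsumN_fin (x : dsum) : exists N, forall l, (N <= l)%N -> - x l = 0.
Proof. by have [N xN] := dsum_fin x; exists N => l /xN ->; rewrite oppr0. Qed.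
Definition dsumN x := DSum (dsumN_fin x).

Lemma dsumD_fin (x y : dsum) : exists N, forall l, (N <= l)%N -> x l + y l = 0.
Proof.
have [[N xN] [M yM]] := (dsum_fin x, dsum_fin y).
by exists (maxn N M) => l; rewrite geq_max => /andP[/xN -> /yM ->]; rewrite addr0.
Qed.
Definition dsumD x y := DSum (dsumD_fin x y).

HB.instance Definition _ := gen_eqMixin dsum.
HB.instance Definition _ := gen_choiceMixin dsum.

Lemma dsumDA : associative dsumD.
Proof. by move=> x y z; apply: dsumP => l /=; rewrite addrA. Qed.
Lemma dsumDC : commutative dsumD.
Proof. by move=> x y; apply: dsumP => l /=; rewrite addrC. Qed.
Lemma dsum0D : left_id dsum0 dsumD.
Proof. by move=> x; apply: dsumP => l /=; rewrite add0r. Qed.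
Lemma dsumND : left_inverse dsum0 dsumN dsumD.
Proof. by move=> x; apply: dsumP => l /=; rewrite addNr. Qed.

HB.instance Definition _ := GRing.isZmodule.Build dsum dsumDA dsumDC dsum0D dsumND.

End DirectSum.

Section DirectSumMap.
Variables (V W : nat -> zmodType) (h : forall l, {additive V l -> W l}).

Lemma dsum_map_fin (x : dsum V) :
  exists N, forall l, (N <= l)%N -> h l (x l) = 0.
Proof. by have [N xN] := dsum_fin x; exists N => l /xN ->; rewrite raddf0. Qed.

Definition dsum_map (x : dsum V) : dsum W := DSum (dsum_map_fin x).

End DirectSumMap.

(* The submodule [I M] of a module [M], for an ideal [I]. *)
Definition ideal_smul (R : nzRingType) (M : lmodType R) (I : R -> Prop) (x : M) :=
  exists s : seq (R * M),
    (forall p, p \in s -> I p.1) /\ x = \sum_(p <- s) p.1 *: p.2.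

Definition ideal_prod (A : nzRingType) (I J : A -> Prop) (x : A) :=
  exists s : seq (A * A),
    (forall p, p \in s -> I p.1 /\ J p.2) /\ x = \sum_(p <- s) p.1 * p.2.

(* [I ^ 0] is the whole ring. *)
Fixpoint ideal_exp (A : nzRingType) (I : A -> Prop) (l : nat) : A -> Prop :=
  if l is l'.+1 then ideal_prod I (ideal_exp I l') else fun=> True.

(* A [vectType] over a ring is a finite free module; [dim] is its rank and [v2r]
   gives the coordinates in a basis. *)
Record freeCover (R : localRing) := FreeCover {
  cover_mod : vectType R;
  cover_map :> {linear cover_mod -> R^o};
  cover_im : forall r : R, maxi R r <-> exists x, cover_map x = r;
  cover_ker : forall x, cover_map x = 0 -> ideal_smul (maxi R) x
}.

Section Koszul.
Variables (R : localRing) (f : freeCover R).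
Notation F := (cover_mod f).

Definition koszul := extn R (dim F).
HB.instance Definition _ := GRing.Algebra.on koszul.

Definition koszul_gen (x : F) : koszul := ext_gen (v2r x).

Lemma koszul_gen_is_linear : linear koszul_gen.
Proof. by move=> r x y; rewrite /koszul_gen !linearP. Qed.
HB.instance Definition _ :=
  GRing.isLinear.Build R F koszul _ koszul_gen koszul_gen_is_linear.

Definition basis_vec (i : 'I_(dim F)) : F := r2v (delta_mx 0 i).

Definition koszul_diff : koszul -> koszul :=
  ext_diff (fun i => f (basis_vec i) : R).
HB.instance Definition _ :=
  GRing.isLinear.Build R koszul koszul _ koszul_diff (ext_diff_is_linear _).

Lemma koszul_diff_gen x : koszul_diff (koszul_gen x) = (f x)%:A.
Proof.
rewrite [LHS]ext_diff_gen -[x in RHS]v2rK [v2r x in RHS]row_sum_delta !linear_sum.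
by congr (_ *: _); apply: eq_bigr => i _; rewrite !linearZ.
Qed.

(* The degree 0 component of [a] is [a set0]. *)
Definition koszul_aug (a : koszul) : residue R :=
  \pi_({ideal_quot (maxi_pred R)})%qT (a set0).

Definition koszul_augker (a : koszul) : Prop := koszul_aug a = 0.

Definition koszul_fil (l : nat) : koszul -> Prop := ideal_exp koszul_augker l.

Lemma koszul_augkerE a : koszul_augker a <-> maxi R (a set0).
Proof.
rewrite /koszul_augker /koszul_aug.
have -> : (0 : residue R) = \pi_({ideal_quot (maxi_pred R)})%qT 0 by rewrite raddf0.
split => [/eqP|am].
  by rewrite -Quotient.idealrBE subr0 => /asboolP.
by apply/eqP; rewrite -Quotient.idealrBE subr0; apply/asboolP.
Qed.

Lemma ideal_exp_koszul_aug_closed l : zmod_closed (fun a => `[< koszul_fil l a >]).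
Proof.
elim: l => [|l [_ IH]]; first by split=> [|x y _ _]; apply/asboolP.
split; first by apply/asboolP; exists [::]; rewrite big_nil; split.
move=> x y /asboolP[s [sJ ->]] /asboolP[s' [s'J ->]]; apply/asboolP.
exists (s ++ [seq (- p.1, p.2) | p <- s']); split.
  move=> p; rewrite mem_cat => /orP[/sJ //|/mapP[q /s'J[q1 q2] ->]]; split=> //=.
  have [[m0 mD mM] _ _] := maxi_maximal R.
  move/koszul_augkerE: q1 => q1; apply/koszul_augkerE.
  by rewrite ffunE -mulN1r; apply: mM.
rewrite big_cat big_map /= -sumrN; congr (_ + _).
by apply: eq_bigr => p _; rewrite mulNr.
Qed.

Definition cycles : {pred koszul} := fun a => koszul_diff a == 0.

Definition boundaries : {pred koszul} := fun a => `[< exists b, a = koszul_diff b >].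

Lemma boundaries_cycles a : a \in boundaries -> a \in cycles.
Proof. by move=> /asboolP[b ->]; rewrite unfold_in [koszul_diff _]ext_diffK. Qed.

Lemma cycles_closed : zmod_closed cycles.
Proof.
split; first by rewrite unfold_in linear0.
by move=> x y; rewrite !unfold_in linearB /= => /eqP-> /eqP->; rewrite subr0.
Qed.
HB.instance Definition _ := GRing.isZmodClosed.Build koszul cycles cycles_closed.

Lemma boundaries_closed : zmod_closed boundaries.
Proof.
split; first by apply/asboolP; exists 0; rewrite linear0.
move=> x y /asboolP[a ->] /asboolP[b ->]; apply/asboolP.
by exists (a - b); rewrite linearB.
Qed.
HB.instance Definition _ :=
  GRing.isZmodClosed.Build koszul boundaries boundaries_closed.

Definition homology := subquot cycles boundaries.
HB.instance Definition _ := GRing.Zmodule.on homology.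

Definition homology_class : subgrp cycles -> homology := @subquot_class _ _ _.

(* The image of the homology of the subcomplex [koszul_fil l]. *)
Definition homology_fil (l : nat) : {pred homology} := fun h =>
  `[< exists2 z : subgrp cycles, koszul_fil l (val z) & h = homology_class z >].

Lemma homology_fil_closed l : zmod_closed (homology_fil l).
Proof.
have [K0 KB] := ideal_exp_koszul_aug_closed l.
split.
  apply/asboolP; exists 0; first by move/asboolP: K0; rewrite raddf0.
  by rewrite /homology_class -[0 in RHS](subrr 0) subquot_classB subrr.
move=> _ _ /asboolP[z zl ->] /asboolP[w wl ->]; apply/asboolP; exists (z - w).
  by rewrite raddfB; apply/asboolP/KB; apply/asboolP.
by rewrite /homology_class subquot_classB.
Qed.
HB.instance Definition _ l :=
  GRing.isZmodClosed.Build homology (homology_fil l) (homology_fil_closed l).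

Definition gr_homology_comp (l : nat) : zmodType :=
  subquot (homology_fil l) (homology_fil l.+1).

Definition gr_homology := dsum gr_homology_comp.

End Koszul.

Arguments cycles {R} f _.
Arguments boundaries {R} f _.
Arguments homology_fil {R} f l _.

Record localHom (R S : localRing) := LocalHom {
  local_hom :> {rmorphism R -> S};
  local_homP : forall r, maxi R r -> maxi S (local_hom r)
}.

(* The lifts [phi] of [alpha]: the pairs [(phi, alpha)] are the morphisms from
   [f] to [g]. *)
Record lift (R S : localRing) (f : freeCover R) (g : freeCover S)
    (alpha : localHom R S) := Lift {
  lift_map :> {linear cover_mod f -> cover_mod g | alpha \; *:%R};
  liftP : forall x, g (lift_map x) = alpha (f x)
}.

Section LiftMap.
Variables (R S : localRing) (f : freeCover R) (g : freeCover S).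
Variables (alpha : localHom R S) (phi : lift f g alpha).

(* The algebra morphism extending [phi]: see [koszul_mapZ], [koszul_map_gen] and
   [koszul_map_diff]. *)
Definition koszul_map : koszul f -> koszul g :=
  ext_lift (in_alg (koszul g) \o alpha) (fun i => koszul_gen (phi (basis_vec i))).

Let u i := koszul_gen (phi (@basis_vec R f i)).

Let u_sq i : u i * u i = 0. Proof. exact: ext_gen_sq. Qed.

Let u_anti i j : u i * u j = - (u j * u i).
Proof. exact: ext_gen_anti. Qed.

Let u_comm r i : (alpha r)%:A * u i = u i * (alpha r)%:A.
Proof. by rewrite mulr_algl mulr_algr. Qed.

Lemma koszul_map_is_additive : zmod_morphism koszul_map.
Proof.
move=> a b; apply: (addIr (koszul_map b)); rewrite subrK.
by rewrite -[LHS]ext_liftD subrK.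
Qed.
HB.instance Definition _ :=
  GRing.isZmodMorphism.Build (koszul f) (koszul g) koszul_map koszul_map_is_additive.

Lemma koszul_map_is_monoid : monoid_morphism koszul_map.
Proof.
split; first exact: ext_lift1.
by move=> a b; have := ext_liftM (rho := in_alg (koszul g) \o alpha) u_comm u_sq u_anti;
  apply.
Qed.
HB.instance Definition _ :=
  GRing.isMonoidMorphism.Build (koszul f) (koszul g) koszul_map koszul_map_is_monoid.

Lemma koszul_mapZ r a : koszul_map (r *: a) = alpha r *: koszul_map a.
Proof. by rewrite [LHS]ext_liftZ mulr_algl. Qed.

Lemma koszul_map_base i : koszul_map (ext_base R [set i]) = u i.
Proof. by rewrite [LHS]ext_lift_base big_set1. Qed.

Lemma koszul_map_gen x : koszul_map (koszul_gen x) = koszul_gen (phi x).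
Proof.
transitivity (\sum_i alpha (v2r x 0 i) *: u i).
  rewrite {1}/koszul_gen /ext_gen raddf_sum; apply: eq_bigr => i _.
  by rewrite /= koszul_mapZ koszul_map_base.
rewrite -[x in RHS]v2rK [v2r x in RHS]row_sum_delta !linear_sum /=.
by apply: eq_bigr => i _; rewrite !linearZ.
Qed.

Lemma koszul_map_diff a : koszul_map (koszul_diff a) = koszul_diff (koszul_map a).
Proof.
elim/ext_ind: a => [a b IHa IHb|r a IHa||i a IHa].
- by rewrite !raddfD /= IHa IHb.
- by rewrite linearZ /= !koszul_mapZ IHa linearZ.
- by rewrite rmorph1 /koszul_diff !ext_diff1 raddf0.
rewrite [koszul_diff _]ext_diff_base1M rmorphB rmorphM /= koszul_mapZ IHa.
rewrite rmorphM /= koszul_map_base [RHS]ext_diffM [ext_diff _ (u i)]koszul_diff_gen.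
by rewrite liftP mulr_algl; congr (_ + _); rewrite -mulNr ext_sign_gen.
Qed.

Lemma koszul_map_aug a : (koszul_map a) set0 = alpha (a set0).
Proof.
elim/ext_ind: a => [a b IHa IHb|r a IHa||i a IHa].
- by rewrite raddfD !ffunE IHa IHb rmorphD.
- by rewrite koszul_mapZ !ext_scaleE IHa rmorphM.
- by rewrite rmorph1 !ffunE rmorph_nat !eqxx.
- by rewrite rmorphM /= koszul_map_base ext_gen_mul0 ext_base1M inE rmorph0.
Qed.

Lemma koszul_map_fil l a : koszul_fil l a -> koszul_fil l (koszul_map a).
Proof.
elim: l a => // l IHl _ [s [sJ ->]].
exists [seq (koszul_map p.1, koszul_map p.2) | p <- s]; split.
  move=> _ /mapP[p /sJ[p1 p2] ->] /=; split; last exact: IHl.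
  move/koszul_augkerE: p1 => p1; apply/koszul_augkerE.
  by rewrite koszul_map_aug; apply: local_homP.
by rewrite big_map rmorph_sum; apply: eq_bigr => p _; rewrite rmorphM.
Qed.

Lemma koszul_map_cycles a : a \in cycles f -> koszul_map a \in cycles g.
Proof. by rewrite !unfold_in -koszul_map_diff => /eqP->; rewrite raddf0. Qed.

Lemma koszul_map_boundaries a :
  a \in boundaries f -> koszul_map a \in boundaries g.
Proof.
move=> /asboolP[b ->]; apply/asboolP; exists (koszul_map b).
exact: koszul_map_diff.
Qed.

Definition homology_map : homology f -> homology g :=
  subquot_map koszul_map_cycles.

HB.instance Definition _ := GRing.isZmodMorphism.Build (homology f) (homology g)
  homology_map (subquot_map_is_additive koszul_map_cycles koszul_map_boundaries).

Lemma homology_map_class z :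
  homology_map (homology_class z) = homology_class (subgrp_map koszul_map_cycles z).
Proof. exact: (subquot_mapE koszul_map_cycles koszul_map_boundaries). Qed.

Lemma homology_map_fil l h :
  h \in homology_fil f l -> homology_map h \in homology_fil g l.
Proof.
move=> /asboolP[z zl ->]; apply/asboolP; rewrite homology_map_class.
by exists (subgrp_map koszul_map_cycles z) => //; apply: koszul_map_fil.
Qed.

Definition gr_homology_comp_map (l : nat) :
    gr_homology_comp f l -> gr_homology_comp g l :=
  subquot_map (@homology_map_fil l).

HB.instance Definition _ l := GRing.isZmodMorphism.Build
  (gr_homology_comp f l) (gr_homology_comp g l) (@gr_homology_comp_map l)
  (subquot_map_is_additive (@homology_map_fil l) (@homology_map_fil l.+1)).

Definition gr_homology_map : gr_homology f -> gr_homology g :=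
  dsum_map gr_homology_comp_map.

End LiftMap.

(* Main.v *)
From mathcomp Require Import all_boot all_algebra boolp.
Require Import Defs.

(** Two lifts of [alpha] differ by a map from [F] into [ker g], and the free
    cover condition puts [ker g] inside [n G].  In the Koszul complex [K(g)],
    with augmentation ideal [J], scalars from [n] and elements of degree one
    both lie in [J], so [phi] and [psi] agree modulo [J ^ 2] on degree one, and
    hence everywhere, since the algebra is generated in degree one and [J ^ 2]
    is a two-sided ideal ([koszul_map_sub_fil2]).  Expanding a product as
    [phi (a b) - psi (a b) = (phi a - psi a) phi b + psi a (phi b - psi b)]
    then shows that the two algebra maps agree on [J ^ l] modulo [J ^ (l + 1)]
    ([koszul_map_sub_fil]).  So the images of a cycle in [J ^ l] differ by a
    cycle in [J ^ (l + 1)], which is equality in the associated graded of the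
    homology. *)

Set Implicit Arguments.
Unset Strict Implicit.
Unset Printing Implicit Defensive.

Import GRing.Theory VectorInternalTheory.
Local Open Scope ring_scope.

Section AugmentationPowers.
Variables (R : localRing) (f : freeCover R).
Implicit Types (a b c : koszul f).

Lemma koszul_filD l a b :
  koszul_fil l a -> koszul_fil l b -> koszul_fil l (a + b).
Proof.
have [K0 KB] := ideal_exp_koszul_aug_closed f l.
move=> aK bK; apply/asboolP; rewrite -[b]opprK -[- b]add0r.
by apply: (KB); [|apply: (KB) => //]; apply/asboolP.
Qed.

Lemma koszul_fil_sum l (I : eqType) (s : seq I) (F : I -> koszul f) :
  (forall i, i \in s -> koszul_fil l (F i)) -> koszul_fil l (\sum_(i <- s) F i).
Proof.
move=> sF; rewrite big_seq; apply: big_ind => //; last exact: koszul_filD.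
by have [/asboolP K0 _] := ideal_exp_koszul_aug_closed f l.
Qed.

Lemma koszul_augkerMl a b : koszul_augker b -> koszul_augker (a * b).
Proof.
move/koszul_augkerE => bm; apply/koszul_augkerE.
have [[_ _ mM] _ _] := maxi_maximal R.
rewrite ffunE (big_pred1 set0) => [|A]; last by rewrite subset0.
by rewrite setDv; apply/mM/mM.
Qed.

Lemma koszul_augker_gen x : koszul_augker (koszul_gen x : koszul f).
Proof.
have [[m0 _ _] _ _] := maxi_maximal R.
by apply/koszul_augkerE; rewrite -[koszul_gen x]mulr1 ext_gen_mul0.
Qed.

Lemma koszul_augker_alg r : maxi R r -> koszul_augker (r%:A : koszul f).
Proof.
by move=> rm; apply/koszul_augkerE; rewrite ext_scaleE ffunE eqxx mulr1.
Qed.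

Lemma koszul_filSM l a b :
  koszul_augker a -> koszul_fil l b -> koszul_fil l.+1 (a * b).
Proof.
move=> aJ bK; exists [:: (a, b)]; rewrite big_seq1; split=> // p.
by rewrite inE => /eqP ->.
Qed.

Lemma koszul_filMl l a b : koszul_fil l b -> koszul_fil l (a * b).
Proof.
case: l => // l [s [sJ ->]]; rewrite mulr_sumr; apply: koszul_fil_sum => p.
move=> /sJ[p1 p2]; rewrite mulrA.
by apply: koszul_filSM => //; apply: koszul_augkerMl.
Qed.

Lemma koszul_filM k l a b :
  koszul_fil k a -> koszul_fil l b -> koszul_fil (k + l) (a * b).
Proof.
move=> aK bK; elim: k a aK => [|k IHk] a; first by move=> _; apply: koszul_filMl.
case=> s [sJ ->]; rewrite mulr_suml; apply: koszul_fil_sum => p /sJ[p1 p2].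
by rewrite -mulrA; apply: koszul_filSM => //; apply: IHk.
Qed.

(** Scalars from the maximal ideal and elements of degree one each contribute
    one factor in the augmentation ideal. *)
Lemma koszul_gen_smul x :
  ideal_smul (maxi R) x -> koszul_fil 2 (koszul_gen x : koszul f).
Proof.
case=> s [sm ->]; rewrite linear_sum; apply: koszul_fil_sum => p /sm pm.
rewrite linearZ /= -mulr_algl -[koszul_gen _]mulr1.
apply: koszul_filSM; first exact: koszul_augker_alg.
by apply: koszul_filSM; first exact: koszul_augker_gen.
Qed.

End AugmentationPowers.

Section TwoLifts.
Variables (R S : localRing) (f : freeCover R) (g : freeCover S).
Variables (alpha : localHom R S) (phi psi : lift f g alpha).

Lemma koszul_map_subM a b :
  koszul_map phi (a * b) - koszul_map psi (a * b) =
    (koszul_map phi a - koszul_map psi a) * koszul_map phi b +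
    koszul_map psi a * (koszul_map phi b - koszul_map psi b).
Proof. by rewrite !rmorphM mulrBl mulrBr addrA subrK. Qed.

(** The difference lies in [ker g], hence in [n G] because [g] is a free
    cover. *)
Lemma koszul_gen_sub_fil2 x :
  koszul_fil 2 (koszul_gen (phi x) - koszul_gen (psi x) : koszul g).
Proof.
rewrite -linearB; apply/koszul_gen_smul/cover_ker.
by rewrite linearB /= !liftP subrr.
Qed.

(** The two maps agree on scalars, and the degree one case propagates to
    products because [J ^ 2] is a two-sided ideal. *)
Lemma koszul_map_sub_fil2 a :
  koszul_fil 2 (koszul_map phi a - koszul_map psi a).
Proof.
elim/ext_ind: a => [a b IHa IHb|r a IHa||i a IHa].
- rewrite (raddfD (koszul_map phi)) (raddfD (koszul_map psi)) opprD addrACA.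
  exact: koszul_filD.
- by rewrite !koszul_mapZ -scalerBr -mulr_algl; apply: koszul_filMl.
- rewrite !rmorph1 subrr.
  by have [/asboolP K0 _] := ideal_exp_koszul_aug_closed g 2.
rewrite koszul_map_subM; apply: koszul_filD; last exact: koszul_filMl.
rewrite !koszul_map_base -[2%N]addn0; apply: koszul_filM => //.
exact: koszul_gen_sub_fil2.
Qed.

(** In a product from [J * J ^ l], replacing [phi] by [psi] in the first factor
    costs a term of [J ^ 2 * J ^ l], and in the second one, by induction, a term
    of [J * J ^ (l + 1)]. *)
Lemma koszul_map_sub_fil l a :
  koszul_fil l a -> koszul_fil l.+1 (koszul_map phi a - koszul_map psi a).
Proof.
elim: l a => [|l IHl] a.
  (* [J ^ 2] is contained in [J]. *)
  move=> _; have [s [sJ ->]] := koszul_map_sub_fil2 a.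
  by exists s; split=> // p /sJ[].
case=> s [sJ ->]; rewrite !rmorph_sum -sumrB; apply: koszul_fil_sum => p /sJ[p1 p2].
rewrite koszul_map_subM; apply: koszul_filD.
  rewrite -[l.+2]add2n; apply: koszul_filM; first exact: koszul_map_sub_fil2.
  exact: koszul_map_fil.
apply: koszul_filSM; last exact: IHl.
move/koszul_augkerE: p1 => p1; apply/koszul_augkerE.
by rewrite koszul_map_aug; apply: local_homP.
Qed.

Lemma homology_map_sub_fil l h : h \in homology_fil f l ->
  homology_map phi h - homology_map psi h \in homology_fil g l.+1.
Proof.
move=> /asboolP[z zl ->]; rewrite !homology_map_class -subquot_classB.
apply/asboolP; eexists; last by [].
exact: koszul_map_sub_fil.
Qed.

End TwoLifts.

Theorem corollary5p9 (R S : localRing) (f : freeCover R) (g : freeCover S)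
    (alpha : localHom R S) (phi psi : lift f g alpha) :
  gr_homology_map phi = gr_homology_map psi.
Proof.
apply: functional_extensionality_dep => x; apply: dsumP => l.
apply/subquot_class_eq; apply: homology_map_sub_fil.
exact: (subgrpP (repr (x l))).
Qed.
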